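(* Let $\theta(q,x)=\sum_{j=0}^{\infty}q^{j(j+1)/2}x^j$. For $q\in(0,1)$ and real $x\geq-q^{-3/2}$, one has $\dfrac{\partial^2\theta}{\partial x^2}(q,x)>0$. Hence, for $q\in(0,1)$, $\dfrac{\partial\theta}{\partial q}(q,x)<0$ for $x\in[-q^{-1/2},0)$ and $\dfrac{\partial\theta}{\partial q}(q,x)>0$ for $x\in(0,\infty)$.
   Context: The partial theta function $\theta(q,x)$ is an entire function of $x$ for each fixed $q$ with $|q|<1$; here $q$ and $x$ are real. *)

(* Defs.v *)
From Stdlib Require Import Reals.
From Coquelicot Require Import Coquelicot.
Open Scope R_scope.

(* The division in the exponent is the one of nat; it is exact because
   j (j + 1) is even. *)
Definition theta (q x : R) : R :=
  Series (fun j : nat => q ^ Nat.div (j * (j + 1)) 2 * x ^ j).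

(* Main.v *)
(** Write T_k = k(k+1)/2 and G(q,y) = sum_k (k+1)(k+2) q^(T_k) y^k.  Then
    theta_xx(q,x) = q^3 G(q, q^2 x) and theta_q(q,x) = (x/2) G(q, q x), so
    everything reduces to G(q,y) > 0 for y >= - sqrt q.  With p = sqrt q and
    y = - p u, u <= 1,
      p G(q,y) = sum_(k >= 1) k(k+1) (-u)^(k-1) p^(k^2).
    When the Gaussian weights p^(k^2) are replaced by the binomials
    C(2m,m+k), the sum is nonnegative: as a polynomial in 1 - u it has
    nonnegative coefficients, by Pascal's rule.  Moreover
    (m^2 - k^2) C(2m,m+k) = 2m(2m-1) C(2m-2,m-1+k) says that the heat flow
    c_k |-> e^(-s k^2) c_k maps each row C(2m,m+.) to a nonnegative combination
    of such rows (this is d^2/dphi^2 acting on powers of 1 + cos phi).  So the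
    weights e^(-s k^2) C(2M,M+k) also give a nonnegative sum; dividing by
    C(2M,M) and letting M tend to infinity leaves the Gaussian.  Strictness
    comes from running the argument with C(2m,m+1)/4 subtracted. *)

Require Import Defs.
From Stdlib Require Import Reals Lra Lia.
From Coquelicot Require Import Coquelicot.
Open Scope R_scope.

(** * Real-valued binomial coefficients *)

Fixpoint binom (n k : nat) : R :=
  match n, k with
  | _, O => 1
  | O, S _ => 0
  | S n', S k' => binom n' k' + binom n' (S k')
  end.

Lemma binom_SS n k : binom (S n) (S k) = binom n k + binom n (S k).
Proof. reflexivity. Qed.

Lemma binom_n0 n : binom n 0 = 1.
Proof. destruct n; reflexivity. Qed.

Lemma binom_ge0 n k : 0 <= binom n k.
Proof.
revert k; induction n as [|n IH]; intros [|k]; simpl; try lra.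
generalize (IH k) (IH (S k)); lra.
Qed.

Lemma binom_gt n k : (n < k)%nat -> binom n k = 0.
Proof.
revert k; induction n as [|n IH]; intros [|k] H; try lia; [reflexivity|].
rewrite binom_SS, !IH by lia; ring.
Qed.

Lemma binom_pos n k : (k <= n)%nat -> 0 < binom n k.
Proof.
revert k; induction n as [|n IH]; intros [|k] H; try lia; simpl; try lra.
generalize (IH k ltac:(lia)) (binom_ge0 n (S k)); lra.
Qed.

Lemma binom_absorb n k : INR (S k) * binom (S n) (S k) = INR (S n) * binom n k.
Proof.
revert k; induction n as [|n IH]; intros k.
  rewrite binom_SS; destruct k; simpl binom; [simpl; ring|].
  rewrite Rplus_0_r, !Rmult_0_r; reflexivity.
rewrite binom_SS, Rmult_plus_distr_l, IH.
destruct k as [|k].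
  rewrite !binom_n0, (S_INR (S n)); simpl (INR 1); ring.
rewrite (S_INR (S k)), Rmult_plus_distr_r, IH, (binom_SS n k), (S_INR (S n)).
ring.
Qed.

Lemma binom_absorb_compl n k : (INR (S n) - INR k) * binom (S n) k = INR (S n) * binom n k.
Proof.
destruct k as [|k]; [rewrite !binom_n0; simpl (INR 0); ring|].
generalize (binom_absorb n k); rewrite binom_SS, (S_INR k); intros H; lra.
Qed.

(** Absorption trades the factor [m + k] for [2m], its complement trades [m - k] for [2m - 1], and
    each lowers the row by one. For [m = 0] there is no lower row, and the right side merely repeats
    the left. *)
Lemma binom_central_lower m k :
  (INR m ^ 2 - INR k ^ 2) * binom (2 * m) (m + k) =
  match m with
  | O => - INR k ^ 2 * binom 0 k
  | S m' => INR (2 * m) * INR (2 * m - 1) * binom (2 * m') (m' + k)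
  end.
Proof.
destruct m as [|m]; [simpl Nat.mul; simpl Nat.add; simpl (INR 0); ring|].
replace (2 * S m)%nat with (S (S (2 * m))) by lia.
replace (S (S (2 * m)) - 1)%nat with (S (2 * m)) by lia.
replace (S m + k)%nat with (S (m + k)) by lia.
generalize (binom_absorb (S (2 * m)) (m + k)) (binom_absorb_compl (2 * m) (m + k)).
set (a := binom (S (S _)) _); set (b := binom (S _) _); set (c := binom (2 * m) _).
rewrite !S_INR, !plus_INR, !mult_INR; simpl (INR 2).
set (x := INR m); set (y := INR k); intros H1 H2.
replace ((((x + 1) ^ 2) - y ^ 2) * a) with ((x + 1 - y) * ((x + y + 1) * a)) by ring.
rewrite H1.
transitivity (((1 + 1) * x + 1 + 1) * (((1 + 1) * x + 1 - (x + y)) * b)); [ring|].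
rewrite H2; ring.
Qed.

(** Three absorptions give the exact ratio 4(2k+3)/(k+3), which is below 8. *)
Lemma binom_ratio_drop3 k :
  binom (2 * (k + 2)) (k + 3) <= 8 * binom (2 * k + 1) k.
Proof.
replace (2 * (k + 2))%nat with (S (S (S (2 * k + 1)))) by lia.
replace (k + 3)%nat with (S (S (S k))) by lia.
generalize (binom_absorb (S (S (2 * k + 1))) (S (S k))).
generalize (binom_absorb (S (2 * k + 1)) (S k)) (binom_absorb (2 * k + 1) k)
  (binom_ge0 (2 * k + 1) k) (pos_INR k).
set (a := binom (S (S (S _))) _); set (b := binom (S (S _)) _); set (c := binom (S _) _).
set (d := binom (2 * k + 1) k).
rewrite !S_INR, !plus_INR, !mult_INR; simpl (INR 2); simpl (INR 1).
set (x := INR k); intros H1 H2 Hd Hx H3.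
assert (c = 2 * d).
  apply (Rmult_eq_reg_l (x + 1)); [|lra]; rewrite H2; ring.
subst c; rewrite H in H1.
assert (b * (x + 2) = (2 * x + 3) * (2 * d)) by lra.
assert (a * (x + 3) = 4 * (2 * x + 3) * d) by nra.
apply (Rmult_le_reg_r (x + 3)); [lra|]; rewrite H4; nra.
Qed.

(** * Nonnegativity of one-sided sums over a binomial row *)

Section Sums.
Variables (x : R) (N : nat).

(* With U := x * tail_sum, tail_sum1 and tail_sum2 are the derivatives U' and U'' in x.
   Once [n <= N] the truncation at [N] loses nothing, as the binomials beyond it vanish. *)
Definition tail_sum n m := sum_f_R0 (fun k => binom n (m + k) * x ^ k) N.
Definition tail_sum1 n m := sum_f_R0 (fun k => INR (k + 1) * binom n (m + k) * x ^ k) N.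
Definition tail_sum2 n m := sum_f_R0 (fun k => INR ((k + 1) * (k + 2)) * binom n (m + 1 + k) * x ^ k) N.

Lemma tail_sum_shift n m :
  tail_sum n m = binom n m + x * tail_sum n (S m) - x ^ (S N) * binom n (S m + N).
Proof.
unfold tail_sum; induction N as [|N' IH].
  simpl; rewrite !Nat.add_0_r; ring.
rewrite !tech5, IH.
replace (S m + S N')%nat with (S (m + S N')) by lia.
replace (S m + N')%nat with (m + S N')%nat by lia.
simpl; ring.
Qed.

(** Pascal's rule followed by an index shift. Iterated, it expands the sum in powers of [1 + x] with
    nonnegative coefficients; the last term is the truncation error, zero for [n <= N]. *)
Lemma tail_sum_rec n m :
  tail_sum (S n) (S m) = (1 + x) * tail_sum n (S m) + binom n m - x ^ (S N) * binom n (S m + N).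
Proof.
transitivity (tail_sum n m + tail_sum n (S m)); [|rewrite tail_sum_shift; ring].
unfold tail_sum; rewrite <- plus_sum; apply sum_eq; intros i _.
rewrite Nat.add_succ_l, binom_SS; ring.
Qed.

(** This is [x] times the previous recursion, differentiated: the product rule adds
    [x * tail_sum n (S m) + binom n m], which [tail_sum_shift] collects into [tail_sum n m].
    Differentiating once more gives the recursion for [tail_sum2]. *)
Lemma tail_sum1_rec n m :
  tail_sum1 (S n) (S m) = (1 + x) * tail_sum1 n (S m) + tail_sum n m
    - INR (S N) * x ^ (S N) * binom n (S m + N).
Proof.
unfold tail_sum1, tail_sum; induction N as [|N' IH].
  unfold sum_f_R0; rewrite !Nat.add_0_r, binom_SS; simpl; ring.
rewrite !tech5, IH.
replace (S m + S N')%nat with (S (m + S N')) by lia.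
replace (S m + N')%nat with (m + S N')%nat by lia.
rewrite binom_SS, !plus_INR, !S_INR; simpl; ring.
Qed.

Lemma tail_sum2_rec n m :
  tail_sum2 (S n) (S m) = (1 + x) * tail_sum2 n (S m) + 2 * tail_sum1 n (S m)
    - INR (S N * (S N + 1)) * x ^ (S N) * binom n (S m + 1 + N).
Proof.
unfold tail_sum1, tail_sum2; induction N as [|N' IH].
  unfold sum_f_R0; rewrite !Nat.add_0_r; replace (S m + 1)%nat with (S (S m)) by lia.
  rewrite binom_SS; simpl; ring.
rewrite !tech5, IH.
replace (S m + 1 + S N')%nat with (S (S m + S N')) by lia.
replace (S m + 1 + N')%nat with (S m + S N')%nat by lia.
rewrite binom_SS, !mult_INR, !plus_INR, !S_INR; simpl; ring.
Qed.

Hypothesis Hx : 0 <= 1 + x.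

Lemma tail_sum_ge n m : (n <= N)%nat -> binom n m <= tail_sum (S n) (S m).
Proof.
assert (H0 : forall n m, (n <= N)%nat -> 0 <= tail_sum n (S m)).
  clear n m; intros n; induction n as [|n IH]; intros m Hn.
    apply Req_le; symmetry; apply sum_eq_R0; intros i _; simpl; ring.
  rewrite tail_sum_rec, (binom_gt n (S m + N)) by lia.
  generalize (Rmult_le_pos _ _ Hx (IH m ltac:(lia))) (binom_ge0 n m); lra.
intros Hn; rewrite tail_sum_rec, (binom_gt n (S m + N)) by lia.
generalize (Rmult_le_pos _ _ Hx (H0 n m Hn)); lra.
Qed.

Lemma tail_sum_ge0 n m : (n <= N)%nat -> 0 <= tail_sum n m.
Proof.
revert m; induction n as [|n IH]; intros m Hn.
  unfold tail_sum; apply Rle_trans with (binom 0 (m + 0) * x ^ 0).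
    rewrite pow_O, Rmult_1_r; apply binom_ge0.
  clear Hn; induction N as [|N' IH]; [apply Rle_refl|].
  rewrite tech5, (binom_gt 0 (m + S N')) by lia; lra.
destruct m as [|m].
  (* Column 0 is outside the recursion. There the sum runs over the full row, so passing to the next
     row is multiplication by [1 + x]. *)
  rewrite tail_sum_shift, (binom_gt (S n) (1 + N)) by lia.
  rewrite tail_sum_rec, (binom_gt n (1 + N)), !binom_n0 by lia.
  generalize (IH 0%nat ltac:(lia)).
  rewrite tail_sum_shift, (binom_gt n (1 + N)), binom_n0 by lia; intros H.
  replace (1 + x * _ - _) with ((1 + x) * (1 + x * tail_sum n 1 - x ^ S N * 0)) by ring.
  apply Rmult_le_pos; lra.
apply Rle_trans with (2 := tail_sum_ge n m ltac:(lia)); apply binom_ge0.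
Qed.

Lemma tail_sum1_ge n m : (n <= N)%nat -> tail_sum n m <= tail_sum1 (S n) (S m).
Proof.
assert (H0 : forall n m, (n <= N)%nat -> 0 <= tail_sum1 n (S m)).
  clear n m; intros n; induction n as [|n IH]; intros m Hn.
    apply Req_le; symmetry; apply sum_eq_R0; intros i _; simpl; ring.
  rewrite tail_sum1_rec, (binom_gt n (S m + N)) by lia.
  generalize (Rmult_le_pos _ _ Hx (IH m ltac:(lia))) (tail_sum_ge0 n m ltac:(lia)); lra.
intros Hn; rewrite tail_sum1_rec, (binom_gt n (S m + N)) by lia.
generalize (Rmult_le_pos _ _ Hx (H0 n m Hn)); lra.
Qed.

(** One row is lost to the Leibniz term [2 * tail_sum1], a second to [tail_sum1_ge]; the terms
    carrying [1 + x] are nonnegative and dropped. *)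
Lemma tail_sum2_ge n m : (n < N)%nat -> 2 * tail_sum n m <= tail_sum2 (S (S n)) (S m).
Proof.
assert (H0 : forall n m, (n <= N)%nat -> 0 <= tail_sum2 n (S m)).
  clear n m; intros n; induction n as [|n IH]; intros m Hn.
    apply Req_le; symmetry; apply sum_eq_R0; intros i _; simpl; ring.
  rewrite tail_sum2_rec, (binom_gt n (S m + 1 + N)) by lia.
  destruct n as [|n].
    replace (tail_sum1 0 (S m)) with 0.
      generalize (Rmult_le_pos _ _ Hx (IH m ltac:(lia))); lra.
    symmetry; apply sum_eq_R0; intros i _; simpl; ring.
  generalize (Rmult_le_pos _ _ Hx (IH m ltac:(lia)))
    (tail_sum1_ge n m ltac:(lia)) (tail_sum_ge0 n m ltac:(lia)); lra.
intros Hn; rewrite tail_sum2_rec, (binom_gt (S n) (S m + 1 + N)) by lia.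
generalize (Rmult_le_pos _ _ Hx (H0 (S n) m Hn)) (tail_sum1_ge n m ltac:(lia)); lra.
Qed.

(** The quantitative margin behind the strict inequality. For [m >= 2], descending three rows gives
    C(2m,m+1) <= 8 C(2m-3,m-2) <= 8 [tail_sum (2m-2) (m-1)] <= 4 [tail_sum2 (2m) m]; rows 0 and 2
    are too short for this and are computed. *)
Lemma tail_sum2_central_ge m : (2 * m <= N)%nat -> binom (2 * m) (m + 1) <= 4 * tail_sum2 (2 * m) m.
Proof.
destruct m as [|[|m]]; intros HN.
- replace (tail_sum2 (2 * 0) 0) with 0; [simpl; lra|].
  symmetry; apply sum_eq_R0; intros i _; simpl; ring.
- unfold tail_sum2; rewrite (decomp_sum _ N) by lia.
  rewrite sum_eq_R0; [simpl; lra|].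
  intros i _; rewrite binom_gt by lia; ring.
- replace (S (S m)) with (m + 2)%nat in * by lia.
  replace (m + 2 + 1)%nat with (m + 3)%nat by lia.
  apply Rle_trans with (1 := binom_ratio_drop3 m).
  generalize (tail_sum2_ge (2 * m + 2) (m + 1) ltac:(lia)) (tail_sum_ge (2 * m + 1) m ltac:(lia)).
  replace (S (S (2 * m + 2))) with (2 * (m + 2))%nat by lia.
  replace (S (m + 1)) with (m + 2)%nat by lia.
  replace (S (2 * m + 1)) with (2 * m + 2)%nat by lia.
  replace (S m) with (m + 1)%nat by lia.
  lra.
Qed.
End Sums.

(** * Heat flow on even binomial rows *)

(** Induction on the row: after rescaling, the time derivative for row [m] is a nonnegative multiple
    of the damped sum for row [m - 1], while time 0 is the hypothesis. Hence the hypothesis for all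
    rows up to [M]. The index [i] stands for k = i + 1. *)
Lemma heat_flow_ge0 (w : nat -> R) (N M : nat) :
  (forall m, (m <= M)%nat -> 0 <= sum_f_R0 (fun i => w i * binom (2 * m) (m + S i)) N) ->
  forall m s, (m <= M)%nat -> 0 <= s ->
  0 <= sum_f_R0 (fun i => w i * exp (- s * INR (S i) ^ 2) * binom (2 * m) (m + S i)) N.
Proof.
intros Hw m; induction m as [|m IH]; intros s Hm Hs.
  apply Req_le; symmetry; apply sum_eq_R0; intros i _; rewrite binom_gt by lia; ring.
set (f := fun t => sum_f_R0 (fun i => w i * exp (t * (INR (S m) ^ 2 - INR (S i) ^ 2))
  * binom (2 * S m) (S m + S i)) N).
set (g := fun t => exp (t * INR (S m) ^ 2) * (INR (2 * S m) * INR (2 * S m - 1) *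
  sum_f_R0 (fun i => w i * exp (- t * INR (S i) ^ 2) * binom (2 * m) (m + S i)) N)).
(* [f t] is the sum at time [t] multiplied by [exp (t m^2)], so that its derivative
   involves only the row below. *)
assert (Hd : forall t, is_derive f t (g t)).
  intros t.
  evar_last.
    apply is_derive_ext with (fun u => sum_n (fun i => w i *
      exp (u * (INR (S m) ^ 2 - INR (S i) ^ 2)) * binom (2 * S m) (S m + S i)) N).
      intros u; apply sum_n_Reals.
    apply (is_derive_sum_n (fun i u => w i *
      exp (u * (INR (S m) ^ 2 - INR (S i) ^ 2)) * binom (2 * S m) (S m + S i)) N t
      (fun i => w i * ((INR (S m) ^ 2 - INR (S i) ^ 2)
         * exp (t * (INR (S m) ^ 2 - INR (S i) ^ 2))) * binom (2 * S m) (S m + S i))).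
    intros k _; generalize (INR (S m) ^ 2 - INR (S k) ^ 2) (binom (2 * S m) (S m + S k)).
    intros a b; auto_derive; [trivial|ring].
  rewrite sum_n_Reals; unfold g.
  rewrite (Rmult_comm (INR _ * INR _)), <- Rmult_assoc, Rmult_comm, <- Rmult_assoc.
  rewrite scal_sum; apply sum_eq; intros i _.
  generalize (binom_central_lower (S m) (S i)); intros Hb.
  rewrite Rmult_minus_distr_l; unfold Rminus; rewrite exp_plus.
  replace (- (t * INR (S i) ^ 2)) with (- t * INR (S i) ^ 2) by ring.
  transitivity (w i * exp (t * INR (S m) ^ 2) * exp (- t * INR (S i) ^ 2) *
    ((INR (S m) ^ 2 - INR (S i) ^ 2) * binom (2 * S m) (S m + S i))); [ring|].
  rewrite Hb; ring.
assert (Hg : forall t, 0 <= t -> 0 <= g t).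
  intros t Ht; unfold g; repeat apply Rmult_le_pos;
    try apply pos_INR; [left; apply exp_pos|apply IH; [lia|exact Ht]].
assert (Hf : 0 <= f s).
  destruct (MVT_gen f 0 s g) as [c [Hc Heq]].
  - intros t _; apply Hd.
  - intros t _; apply derivable_continuous_pt; exists (g t); apply is_derive_Reals, Hd.
  - rewrite Rmin_left in Hc by exact Hs.
    assert (H0 : 0 <= f 0).
      apply Rle_trans with (1 := Hw (S m) Hm), Req_le, sum_eq; intros i _.
      rewrite Rmult_0_l, exp_0; ring.
    generalize (Rmult_le_pos _ _ (Hg c (proj1 Hc)) Hs); lra.
replace (sum_f_R0 _ N) with (exp (- s * INR (S m) ^ 2) * f s).
  apply Rmult_le_pos; [left; apply exp_pos|exact Hf].
unfold f; rewrite scal_sum; apply sum_eq; intros i _.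
replace (- s * INR (S i) ^ 2) with (- s * INR (S m) ^ 2 + s * (INR (S m) ^ 2 - INR (S i) ^ 2)) by ring.
rewrite exp_plus; ring.
Qed.

(** * From binomial to Gaussian weights *)

(** Neighbouring binomials have ratio (M-k)/(M+k+1) = 1 - (2k+1)/(M+k+1), which tends to 1; induct
    on [k]. *)
Lemma binom_central_ratio_lim k :
  is_lim_seq (fun M => binom (2 * M) (M + k) / binom (2 * M) M) 1.
Proof.
induction k as [|k IH].
  apply is_lim_seq_ext with (2 := is_lim_seq_const 1); intros M.
  rewrite Nat.add_0_r; field; apply Rgt_not_eq, binom_pos; lia.
assert (Hr : is_lim_seq (fun M => 1 - INR (2 * k + 1) * / INR (M + S k)) 1).
  evar_last.
    apply is_lim_seq_minus'; [apply is_lim_seq_const|].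
    apply is_lim_seq_mult'; [apply is_lim_seq_const|].
    apply is_lim_seq_incr_n with (u := fun n => / INR n).
    apply is_lim_seq_inv with (1 := is_lim_seq_INR); discriminate.
  apply f_equal; simpl; ring.
evar_last.
  apply is_lim_seq_ext with (2 := is_lim_seq_mult' _ _ _ _ IH Hr); intros M.
  assert (H := binom_pos (2 * M) M ltac:(lia)).
  assert (Hstep : binom (2 * M) (M + S k) =
      binom (2 * M) (M + k) * (1 - INR (2 * k + 1) * / INR (M + S k))).
    replace (M + S k)%nat with (S (M + k)) by lia.
    generalize (binom_absorb (2 * M) (M + k)).
    rewrite binom_SS; set (a := binom _ (M + k)); set (b := binom _ (S _)).
    rewrite !S_INR, !plus_INR, !mult_INR; simpl (INR 2); simpl (INR 1).
    generalize (pos_INR M) (pos_INR k); intros HM Hk H1.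
    apply (Rmult_eq_reg_l (INR M + INR k + 1)); [|lra].
    field_simplify; lra.
  rewrite Hstep; unfold Rdiv; ring.
apply f_equal; ring.
Qed.

Lemma binom_le_central M k : binom (2 * M) (M + k) <= binom (2 * M) M.
Proof.
induction k as [|k IH]; [rewrite Nat.add_0_r; apply Rle_refl|].
apply Rle_trans with (2 := IH).
rewrite Nat.add_succ_r.
generalize (binom_absorb (2 * M) (M + k)) (binom_ge0 (2 * M) (M + k)) (binom_ge0 (2 * M) (S (M + k))).
rewrite binom_SS, (S_INR (2 * M)), (S_INR (M + k)), !plus_INR, !mult_INR; simpl (INR 2).
generalize (pos_INR M) (pos_INR k); nra.
Qed.

(** A one-sided Tannery theorem: cut at [K], bound the rest by the tail of the absolute series, let
    [M] and then [K] tend to infinity. *)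
Lemma tannery_ge0 (x : nat -> R) (a : nat -> nat -> R) (N : nat -> nat) :
  ex_series (fun i => Rabs (x i)) ->
  (forall M, (M <= N M)%nat) ->
  (forall M i, 0 <= a M i <= 1) ->
  (forall i, is_lim_seq (fun M => a M i) 1) ->
  (forall M, 0 <= sum_f_R0 (fun i => x i * a M i) (N M)) ->
  0 <= Series x.
Proof.
intros Hx HN Ha Hlim Hpos.
set (A := Series (fun i => Rabs (x i))).
assert (HA : is_lim_seq (sum_f_R0 (fun i => Rabs (x i))) A).
  apply is_lim_seq_ext with (2 := Series_correct _ Hx); intros n; apply sum_n_Reals.
assert (HS : is_lim_seq (sum_f_R0 x) (Series x)).
  apply is_lim_seq_ext with (2 := Series_correct _ (ex_series_Rabs _ Hx)).
  intros n; apply sum_n_Reals.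
assert (HAle : forall n, sum_f_R0 (fun i => Rabs (x i)) n <= A).
  intros n; apply (is_lim_seq_incr_compare _ _ HA).
  intros k; rewrite tech5; generalize (Rabs_pos (x (S k))); lra.
(* The weighted sum minus the absolute sum never increases with the cutoff, because every weight
   lies in [0,1]. *)
assert (Hdec : forall M K n, sum_f_R0 (fun i => x i * a M i) (K + n)
    - sum_f_R0 (fun i => Rabs (x i)) (K + n)
    <= sum_f_R0 (fun i => x i * a M i) K - sum_f_R0 (fun i => Rabs (x i)) K).
  intros M K n; induction n as [|n IH]; [rewrite Nat.add_0_r; lra|].
  rewrite Nat.add_succ_r, !tech5.
  enough (x (S (K + n)) * a M (S (K + n)) <= Rabs (x (S (K + n)))) by lra.
  apply Rle_trans with (1 := Rle_abs _); rewrite Rabs_mult, (Rabs_pos_eq (a _ _)) by apply Ha.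
  generalize (Rabs_pos (x (S (K + n)))) (Ha M (S (K + n))); nra.
assert (HK : forall K, 0 <= sum_f_R0 x K + (A - sum_f_R0 (fun i => Rabs (x i)) K)).
  intros K.
  assert (HlimK : is_lim_seq (fun M => sum_f_R0 (fun i => x i * a M i) K) (sum_f_R0 x K)).
    induction K as [|K IH].
      simpl; evar_last; [apply is_lim_seq_mult'; [apply is_lim_seq_const|apply Hlim]|].
      apply f_equal; ring.
    simpl; evar_last.
      apply is_lim_seq_plus'; [exact IH|].
      apply is_lim_seq_mult'; [apply is_lim_seq_const|apply Hlim].
    apply f_equal; ring.
  enough (H : Rbar_le (- (A - sum_f_R0 (fun i => Rabs (x i)) K)) (sum_f_R0 x K)) by (simpl in H; lra).
  apply is_lim_seq_le_loc with (2 := is_lim_seq_const _) (3 := HlimK).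
  exists K; intros M HM.
  generalize (Hpos M) (Hdec M K (N M - K)%nat) (HAle (N M)).
  generalize (HN M); intros HNM.
  replace (K + (N M - K))%nat with (N M) by lia; lra.
assert (HL := is_lim_seq_plus' _ _ _ _ HS (is_lim_seq_minus' _ _ _ _ (is_lim_seq_const A) HA)).
generalize (is_lim_seq_le _ _ _ _ HK (is_lim_seq_const 0) HL); simpl; lra.
Qed.

Lemma ex_series_Rabs_le (a b : nat -> R) :
  (forall n, Rabs (a n) <= b n) -> ex_series b -> ex_series (fun n => Rabs (a n)).
Proof.
intros H; apply (@ex_series_le R_AbsRing R_CompleteNormedModule); intros n.
change (Rabs (Rabs (a n)) <= b n); rewrite Rabs_Rabsolu; apply H.
Qed.

(** The lower bound is the k = 1 Gaussian term with weight 1/4. Removing that weight keeps the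
    binomial sums nonnegative by [tail_sum2_central_ge] at [x = - u]; the heat flow and then Tannery
    carry this over to the Gaussian. *)
Lemma gauss_sum_ge (u s : R) : u <= 1 -> 0 <= s ->
  ex_series (fun i => Rabs (INR ((i + 1) * (i + 2)) * (- u) ^ i * exp (- s * INR (S i) ^ 2))) ->
  exp (- s) / 4 <= Series (fun i => INR ((i + 1) * (i + 2)) * (- u) ^ i * exp (- s * INR (S i) ^ 2)).
Proof.
intros Hu Hs Hex.
set (c := fun i => INR ((i + 1) * (i + 2)) * (- u) ^ i).
set (d := fun i : nat => match i with O => / 4 | _ => 0 end).
set (w := fun i => c i - d i).
assert (Hd : is_series (fun i => d i * exp (- s * INR (S i) ^ 2)) (exp (- s) / 4)).
  apply is_series_decr_1; evar_last.
    apply is_series_ext with (fun _ => 0); [intros n; simpl; ring|].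
    apply (is_lim_seq_ext (fun _ => 0) _ 0); [|apply is_lim_seq_const].
    intros n; rewrite sum_n_const; ring.
  unfold plus, opp; simpl; replace (- s * (1 * (1 * 1))) with (- s) by ring; field.
assert (Hda : ex_series (fun i => Rabs (d i * exp (- s * INR (S i) ^ 2)))).
  exists (exp (- s) / 4); apply is_series_ext with (2 := Hd); intros i; symmetry.
  apply Rabs_pos_eq, Rmult_le_pos; [|left; apply exp_pos]; destruct i; simpl; lra.
assert (Hw : 0 <= Series (fun i => w i * exp (- s * INR (S i) ^ 2))).
  apply tannery_ge0 with (a := fun M i => binom (2 * M) (M + S i) / binom (2 * M) M)
    (N := fun M => (2 * M)%nat).
  - apply ex_series_Rabs_le with (fun i => Rabs (c i * exp (- s * INR (S i) ^ 2))
      + Rabs (d i * exp (- s * INR (S i) ^ 2))).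
      intros i; unfold w; rewrite Rmult_minus_distr_r; apply Rle_trans with (1 := Rabs_triang _ _).
      rewrite Rabs_Ropp; apply Rle_refl.
    exact (ex_series_plus _ _ Hex Hda).
  - intros M; lia.
  - intros M i; generalize (binom_pos (2 * M) M ltac:(lia)); intros H.
    generalize (binom_le_central M (S i)) (binom_ge0 (2 * M) (M + S i)); intros H1 H2.
    split; [apply Rdiv_le_0_compat; assumption|].
    apply Rle_div_l; lra.
  - intros i; apply binom_central_ratio_lim.
  - intros M; generalize (binom_pos (2 * M) M ltac:(lia)); intros H.
    replace (sum_f_R0 _ _) with (/ binom (2 * M) M *
      sum_f_R0 (fun i => w i * exp (- s * INR (S i) ^ 2) * binom (2 * M) (M + S i)) (2 * M)).
      apply Rmult_le_pos; [left; apply Rinv_0_lt_compat, H|].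
      apply (heat_flow_ge0 w (2 * M) M); [|lia|exact Hs].
      intros m Hm.
      generalize (tail_sum2_central_ge (- u) (2 * M) ltac:(lra) m ltac:(lia)); intros HW.
      (* The [c] part is [tail_sum2]; the [d] part survives only at index 0, which is k = 1. *)
      replace (sum_f_R0 _ _) with (tail_sum2 (- u) (2 * M) (2 * m) m - / 4 * binom (2 * m) (m + 1)); [lra|].
      rewrite (sum_eq _ (fun i => c i * binom (2 * m) (m + S i) - d i * binom (2 * m) (m + S i)))
        by (intros i _; unfold w; ring).
      rewrite minus_sum; unfold tail_sum2; f_equal.
        apply sum_eq; intros i _; unfold c.
        replace (m + S i)%nat with (m + 1 + i)%nat by lia; ring.
      destruct (2 * M)%nat as [|n]; [reflexivity|].
      rewrite (decomp_sum _ (S n)) by lia; rewrite sum_eq_R0; [unfold d; ring|].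
      intros i _; unfold d; ring.
    rewrite scal_sum; apply sum_eq; intros i _; field; lra.
rewrite <- (is_series_unique _ _ Hd).
rewrite (Series_ext _ (fun i => c i * exp (- s * INR (S i) ^ 2)
  - d i * exp (- s * INR (S i) ^ 2))) in Hw by (intros i; unfold w; ring).
rewrite Series_minus in Hw; [unfold c in Hw; lra|apply ex_series_Rabs, Hex|apply ex_series_Rabs, Hda].
Qed.

(** * Termwise differentiation in the base of the powers *)

(** The error for [n + 1] is [s] times the error for [n] plus n q^(n-1) (s-q)^2, and n^2 + n <=
    (n+1)^2. Writing r^n / r^2 avoids a truncated exponent for small [n]. *)
Lemma pow_taylor1 (n : nat) (r s q : R) : 0 < r -> 0 <= s <= r -> 0 <= q <= r ->
  Rabs (s ^ n - q ^ n - (s - q) * (INR n * q ^ pred n)) <= (s - q) ^ 2 * (INR n ^ 2 * r ^ n) / r ^ 2.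
Proof.
intros Hr Hs Hq; induction n as [|n IH].
  simpl; rewrite Rabs_right; [|lra].
  apply Req_le; field; lra.
assert (Hn : INR n * q ^ pred n <= INR n * r ^ n / r).
  destruct n as [|n]; [simpl; apply Req_le; field; lra|].
  replace (INR (S n) * r ^ S n / r) with (INR (S n) * r ^ n) by (simpl pow; field; lra).
  apply Rmult_le_compat_l; [apply pos_INR|apply pow_incr; simpl; lra].
replace (s ^ S n - _ - _) with
  (s * (s ^ n - q ^ n - (s - q) * (INR n * q ^ pred n)) + INR n * q ^ pred n * (s - q) ^ 2).
  assert (H0 : 0 <= INR n * q ^ pred n).
    apply Rmult_le_pos; [apply pos_INR|apply pow_le; lra].
  assert (H1 : 0 <= r ^ n) by (apply pow_le; lra).
  assert (H2 := pos_INR n).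
  apply Rle_trans with (1 := Rabs_triang _ _).
  rewrite !Rabs_mult, (Rabs_pos_eq s), <- (Rabs_mult (INR n)), (Rabs_pos_eq (INR n * _)) by lra.
  rewrite (Rabs_pos_eq ((s - q) ^ 2)) by apply pow2_ge_0.
  apply Rle_trans with (r * ((s - q) ^ 2 * (INR n ^ 2 * r ^ n) / r ^ 2)
    + INR n * r ^ n / r * (s - q) ^ 2).
    apply Rplus_le_compat.
      apply Rmult_le_compat; [lra|apply Rabs_pos|lra|exact IH].
    apply Rmult_le_compat_r; [apply pow2_ge_0|exact Hn].
  replace (r * _ + _) with ((s - q) ^ 2 * ((INR n ^ 2 + INR n) * r ^ S n) / r ^ 2)
    by (simpl pow; field; lra).
  apply Rmult_le_compat_r; [left; apply Rinv_0_lt_compat, pow_lt, Hr|].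
  apply Rmult_le_compat_l; [apply pow2_ge_0|].
  apply Rmult_le_compat_r; [apply pow_le; lra|].
  rewrite S_INR; nra.
rewrite S_INR; destruct n as [|n]; simpl; ring.
Qed.

(** Summing the Taylor bounds gives an error of at most [K] times h^2 for the whole series; the
    second summability hypothesis makes [K] meaningful. *)
Lemma is_derive_Series_pow (c : nat -> R) (e : nat -> nat) (q r : R) : 0 < q < r ->
  ex_series (fun j => Rabs (c j) * r ^ e j) ->
  ex_series (fun j => Rabs (c j) * (INR (e j) ^ 2 * r ^ e j)) ->
  is_derive (fun s => Series (fun j => c j * s ^ e j)) q
    (Series (fun j => c j * (INR (e j) * q ^ pred (e j)))).
Proof.
intros Hq H0 H2.
assert (Hs : forall s, 0 <= s <= r -> ex_series (fun j => c j * s ^ e j)).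
  intros s Hs; apply ex_series_Rabs, ex_series_Rabs_le with (2 := H0); intros j.
  rewrite Rabs_mult; apply Rmult_le_compat_l; [apply Rabs_pos|].
  rewrite Rabs_pos_eq by (apply pow_le; lra); apply pow_incr, Hs.
assert (H1 : ex_series (fun j => c j * (INR (e j) * q ^ pred (e j)))).
  apply ex_series_Rabs.
  apply ex_series_Rabs_le with (fun j => / r * (Rabs (c j) * (INR (e j) ^ 2 * r ^ e j)));
    [|exact (ex_series_scal_l (/ r) _ H2)].
  intros j; rewrite Rabs_mult.
  replace (/ r * _) with (Rabs (c j) * (/ r * (INR (e j) ^ 2 * r ^ e j))) by ring.
  apply Rmult_le_compat_l; [apply Rabs_pos|].
  rewrite Rabs_pos_eq by (apply Rmult_le_pos; [apply pos_INR|apply pow_le; lra]).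
  destruct (e j) as [|n]; [simpl; lra|].
  replace (/ r * _) with (INR (S n) ^ 2 * r ^ n) by (simpl pow; field; lra).
  apply Rmult_le_compat; [apply pos_INR|apply pow_le; simpl; lra| |apply pow_incr; simpl; lra].
  rewrite S_INR; generalize (pos_INR n); nra.
set (K := Series (fun j => Rabs (c j) * (INR (e j) ^ 2 * r ^ e j)) / r ^ 2).
set (F := fun s => Series (fun j => c j * s ^ e j)).
set (l := Series (fun j => c j * (INR (e j) * q ^ pred (e j)))).
assert (HF : forall h, Rabs h < Rmin q (r - q) -> Rabs (F (q + h) - F q - h * l) <= h ^ 2 * K).
  intros h Hh.
  assert (Hh' : 0 <= q + h <= r).
    generalize (Rmin_l q (r - q)) (Rmin_r q (r - q)); apply Rabs_def2 in Hh; lra.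
  set (E := fun j => c j * ((q + h) ^ e j - q ^ e j - h * (INR (e j) * q ^ pred (e j)))).
  replace (F (q + h) - F q - h * l) with (Series E).
    assert (HE : forall j, Rabs (E j) <= h ^ 2 / r ^ 2 * (Rabs (c j) * (INR (e j) ^ 2 * r ^ e j))).
      intros j; unfold E; rewrite Rabs_mult.
      replace (h ^ 2 / _ * _) with (Rabs (c j) * (h ^ 2 * (INR (e j) ^ 2 * r ^ e j) / r ^ 2))
        by (field; lra).
      apply Rmult_le_compat_l; [apply Rabs_pos|].
      generalize (pow_taylor1 (e j) r (q + h) q ltac:(lra) Hh' ltac:(lra)).
      replace (q + h - q) with h by ring; trivial.
    assert (Hb := ex_series_scal_l (h ^ 2 / r ^ 2) _ H2).
    apply Rle_trans with (1 := Series_Rabs _ (ex_series_Rabs_le _ _ HE Hb)).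
    unfold K; replace (h ^ 2 * _) with
      (h ^ 2 / r ^ 2 * Series (fun j => Rabs (c j) * (INR (e j) ^ 2 * r ^ e j))) by (field; lra).
    rewrite <- Series_scal_l; apply Series_le; [|exact Hb].
    intros j; split; [apply Rabs_pos|apply HE].
  unfold F, l; rewrite <- Series_scal_l.
  assert (Hl : ex_series (fun j => h * (c j * (INR (e j) * q ^ pred (e j)))))
    by exact (ex_series_scal_l h _ H1).
  assert (Hd : ex_series (fun j => c j * (q + h) ^ e j - c j * q ^ e j))
    by exact (ex_series_minus _ _ (Hs (q + h) Hh') (Hs q ltac:(lra))).
  rewrite <- (Series_minus _ _ (Hs (q + h) Hh') (Hs q ltac:(lra))).
  rewrite <- (Series_minus _ _ Hd Hl).
  apply Series_ext; intros j; unfold E; ring.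
(* Read off from [HF] at one nonzero admissible increment. *)
assert (HK : 0 <= K).
  assert (Ha : Rabs (Rmin q (r - q) / 2) < Rmin q (r - q)).
    assert (0 < Rmin q (r - q)) by (apply Rmin_glb_lt; lra).
    rewrite Rabs_pos_eq; lra.
  assert (Hm : 0 < Rmin q (r - q)) by (apply Rmin_glb_lt; lra).
  generalize (Rle_trans _ _ _ (Rabs_pos _) (HF _ Ha)); intros H.
  apply Rmult_le_reg_l with ((Rmin q (r - q) / 2) ^ 2); [apply pow_lt; lra|lra].
apply is_derive_Reals; intros eps Heps.
(* The first bound keeps [q + h] in [0,r]; the second uses [K + 1] since [K] may be 0. *)
assert (Hm : 0 < Rmin (Rmin q (r - q)) (eps / (K + 1))).
  repeat apply Rmin_glb_lt; try lra; apply Rdiv_lt_0_compat; lra.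
exists (mkposreal _ Hm); simpl; intros h Hh0 Hh.
assert (Hh1 : Rabs h < Rmin q (r - q)) by (apply Rlt_le_trans with (1 := Hh), Rmin_l).
assert (Hh2 : Rabs h * (K + 1) < eps).
  apply Rlt_div_r; [lra|apply Rlt_le_trans with (1 := Hh), Rmin_r].
assert (Hp := Rabs_pos_lt h Hh0).
fold (F (q + h)) (F q).
replace ((F (q + h) - F q) / h - l) with ((F (q + h) - F q - h * l) / h) by (field; exact Hh0).
unfold Rdiv; rewrite Rabs_mult, Rabs_inv; apply Rlt_div_l; [exact Hp|].
apply Rle_lt_trans with (1 := HF h Hh1).
rewrite <- (pow2_abs h); nra.
Qed.

(** * Triangular exponents, convergence, and positivity of G *)

Definition tri (j : nat) : nat := (j * (j + 1) / 2)%nat.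

Lemma tri_S j : tri (S j) = (tri j + S j)%nat.
Proof.
unfold tri; replace (S j * (S j + 1))%nat with (j * (j + 1) + S j * 2)%nat by lia.
apply Nat.div_add; lia.
Qed.

Lemma double_tri j : (2 * tri j = j * (j + 1))%nat.
Proof. induction j as [|j IH]; [reflexivity|rewrite tri_S; lia]. Qed.

(** Ratio test: the quotient ((n+2)/(n+1))^d q^(n+1) is at most 2^d q^n. The factor [INR (S j) ^ d]
    leaves room for the polynomial factors from differentiation, and [S j] keeps all coefficients
    nonzero. *)
Lemma CV_radius_pow_tri (d : nat) (q : R) : 0 < q < 1 ->
  CV_radius (fun j => INR (S j) ^ d * q ^ tri j) = p_infty.
Proof.
intros Hq; apply CV_radius_infinite_DAlembert.
  intros n; apply Rgt_not_eq, Rmult_lt_0_compat; apply pow_lt; [apply lt_0_INR; lia|lra].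
apply is_lim_seq_le_le with (u := fun _ => 0) (w := fun n => 2 ^ d * q ^ n).
- intros n; split; [apply Rabs_pos|].
  assert (Hn : 0 < INR (S n)) by (apply lt_0_INR; lia).
  rewrite tri_S, pow_add.
  replace (_ / _) with ((INR (S (S n)) / INR (S n)) ^ d * q ^ S n).
    rewrite Rabs_pos_eq.
      apply Rmult_le_compat.
      + apply pow_le, Rdiv_le_0_compat; [apply pos_INR|exact Hn].
      + apply pow_le; lra.
      + apply pow_incr; split; [apply Rdiv_le_0_compat; [apply pos_INR|exact Hn]|].
        apply Rle_div_l; [exact Hn|]; rewrite !S_INR in *; generalize (pos_INR n); lra.
      + simpl; generalize (pow_le q n ltac:(lra)); nra.
    apply Rmult_le_pos; apply pow_le; [|lra].
    apply Rdiv_le_0_compat; [apply pos_INR|exact Hn].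
  unfold Rdiv; rewrite Rpow_mult_distr, pow_inv.
  field; split; apply pow_nonzero; lra.
- apply is_lim_seq_const.
- evar_last.
    apply is_lim_seq_mult'; [apply is_lim_seq_const|apply is_lim_seq_geom].
    rewrite Rabs_pos_eq; lra.
  apply f_equal; ring.
Qed.

Lemma ex_series_pow_tri (d : nat) (q x : R) : 0 < q < 1 ->
  ex_series (fun j => Rabs (INR (S j) ^ d * q ^ tri j * x ^ j)).
Proof.
intros Hq.
apply (CV_disk_inside (fun j => INR (S j) ^ d * q ^ tri j)).
rewrite CV_radius_pow_tri by exact Hq; exact I.
Qed.

(* The function G of the header. *)
Definition theta2 (q y : R) : R :=
  Series (fun k => INR ((k + 1) * (k + 2)) * q ^ tri k * y ^ k).

Lemma theta2_pos (q y : R) : 0 < q < 1 -> - sqrt q <= y -> 0 < theta2 q y.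
Proof.
intros Hq Hy.
assert (Hp : 0 < sqrt q) by (apply sqrt_lt_R0; lra).
assert (Hpq : sqrt q ^ 2 = q) by (apply pow2_sqrt; lra).
set (p := sqrt q) in *.
assert (Hp1 : p < 1) by nra.
(* Take u = -y/p and s = -ln p; the square is completed by 1 + 2 [tri k] + k = (k+1)^2. *)
assert (Hterm : forall k, INR ((k + 1) * (k + 2)) * (- (- y / p)) ^ k * exp (- - ln p * INR (S k) ^ 2)
    = p * (INR ((k + 1) * (k + 2)) * q ^ tri k * y ^ k)).
  intros k.
  replace (- - ln p * INR (S k) ^ 2) with (INR (1 + 2 * tri k + k) * ln p).
    fold (Rpower p (INR (1 + 2 * tri k + k))).
    rewrite Rpower_pow, !pow_add, pow_1, pow_mult, Hpq by exact Hp.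
    replace (- (- y / p)) with (y / p) by (field; lra).
    unfold Rdiv; rewrite Rpow_mult_distr, pow_inv; field; apply pow_nonzero; lra.
  rewrite double_tri, Ropp_involutive, Rmult_comm, <- pow_INR; f_equal; f_equal; simpl; lia.
assert (Hlog : 0 <= - ln p) by (generalize (ln_increasing p 1 Hp Hp1); rewrite ln_1; lra).
assert (Hu : - y / p <= 1) by (apply Rle_div_l; lra).
generalize (gauss_sum_ge _ _ Hu Hlog); rewrite (Series_ext _ _ Hterm), Series_scal_l.
fold (theta2 q y); rewrite Ropp_involutive, exp_ln by exact Hp; intros H.
enough (p / 4 <= p * theta2 q y) by nra.
(* The 2 comes from (k+1)(k+2) <= 2 (k+1)^2. *)
apply H, ex_series_Rabs_le with (fun k => p * 2 * Rabs (INR (S k) ^ 2 * q ^ tri k * y ^ k)).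
  intros k; rewrite <- Ropp_involutive with (r := ln p), Hterm.
  rewrite !Rabs_mult, (Rabs_pos_eq p), (Rabs_pos_eq (INR _)), (Rabs_pos_eq (INR _ ^ 2)); try lra.
  - rewrite mult_INR, S_INR, !plus_INR; simpl (INR 1); simpl (INR 2).
    generalize (pos_INR k) (Rmult_le_pos _ _ (Rabs_pos (q ^ tri k)) (Rabs_pos (y ^ k))).
    set (b := Rabs (q ^ tri k)); set (c := Rabs (y ^ k)); set (a := INR k); intros Ha Hbc.
    replace (p * _) with (p * (b * c) * ((a + 1) * (a + (1 + 1)))) by ring.
    replace (p * 2 * _) with (p * (b * c) * (2 * (a + 1) ^ 2)) by ring.
    apply Rmult_le_compat_l; nra.
  - apply pow_le, pos_INR.
  - apply pos_INR.
exact (ex_series_scal_l (p * 2) _ (ex_series_pow_tri 2 q y Hq)).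
Qed.

(** * The derivatives of theta and their signs *)

(** The shift [tri (k + 2)] = [tri k] + 2k + 3 yields the factor q^3 and rescales [x] to q^2 x. *)
Lemma theta_derive_n_2 (q x : R) : 0 < q < 1 ->
  ex_derive_n (fun t => theta q t) 2 x /\
  Derive_n (fun t => theta q t) 2 x = q ^ 3 * theta2 q (q ^ 2 * x).
Proof.
intros Hq.
assert (Hcv : Rbar_lt (Rabs x) (CV_radius (fun j => q ^ tri j))).
  rewrite <- (CV_radius_ext (fun j => INR (S j) ^ 0 * q ^ tri j)) by (intros j; simpl; ring).
  rewrite CV_radius_pow_tri by exact Hq; exact I.
change (fun t => theta q t) with (PSeries (fun j => q ^ tri j)).
split; [apply ex_derive_n_PSeries, Hcv|].
rewrite Derive_n_PSeries by exact Hcv.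
unfold theta2; rewrite <- Series_scal_l; apply Series_ext; intros k.
unfold PS_derive_n; replace (k + 2)%nat with (S (S k)) by lia.
rewrite !tri_S, !fact_simpl, !mult_INR, Rpow_mult_distr, <- pow_mult.
replace (tri k + S k + S (S k))%nat with (3 + tri k + 2 * k)%nat by lia.
replace (k + 1)%nat with (S k) by lia.
rewrite !pow_add; field; apply INR_fact_neq_0.
Qed.

(** Differentiating q^[tri (k + 1)] gives the factor (k+1)(k+2)/2 and the exponent [tri k + k],
    whence x/2 and the argument q x. *)
Lemma theta_is_derive_q (q x : R) : 0 < q < 1 ->
  is_derive (fun s => theta s x) q (x / 2 * theta2 q (q * x)).
Proof.
intros Hq; set (r := (1 + q) / 2).
assert (Hr : 0 < r < 1) by (unfold r; lra).
(* Since [tri j] <= (j+1)^2, up to two factors [tri j] cost at most (j+1)^4. *)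
assert (Hbound : forall j d, (d <= 2)%nat ->
    Rabs (Rabs (x ^ j) * (INR (tri j) ^ d * r ^ tri j)) <= Rabs (INR (S j) ^ 4 * r ^ tri j * x ^ j)).
  intros j d Hd; rewrite !Rabs_mult, Rabs_Rabsolu.
  rewrite (Rabs_pos_eq (INR (tri j) ^ d)), (Rabs_pos_eq (INR (S j) ^ 4))
    by apply pow_le, pos_INR.
  rewrite (Rmult_comm (Rabs (x ^ j))), 2!Rmult_assoc.
  apply Rmult_le_compat_r; [apply Rmult_le_pos; apply Rabs_pos|].
  replace 4%nat with (2 * 2)%nat by lia; rewrite pow_mult.
  assert (H : INR (tri j) <= INR (S j) ^ 2).
    rewrite <- pow_INR; apply le_INR; generalize (double_tri j); simpl; lia.
  assert (H1 : 1 <= INR (S j) ^ 2) by (rewrite S_INR; generalize (pos_INR j); nra).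
  assert (H2 := pos_INR (tri j)).
  set (z := INR (S j) ^ 2) in *.
  destruct d as [|[|[|d]]]; [rewrite pow_O; nra|rewrite pow_1; nra|apply pow_incr; lra|lia].
assert (Hex : forall d, (d <= 2)%nat ->
    ex_series (fun j => Rabs (x ^ j) * (INR (tri j) ^ d * r ^ tri j))).
  intros d Hd; apply ex_series_Rabs.
  apply ex_series_Rabs_le with (2 := ex_series_pow_tri 4 r x Hr); intros j; apply Hbound, Hd.
assert (H0 : ex_series (fun j => Rabs (x ^ j) * r ^ tri j)).
  apply ex_series_ext with (2 := Hex 0%nat ltac:(lia)); intros j; simpl; ring.
assert (Hqr : 0 < q < r) by (unfold r; lra).
assert (Hder := is_derive_Series_pow (fun j => x ^ j) tri q r Hqr H0 (Hex 2%nat ltac:(lia))).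
evar_last.
  apply is_derive_ext with (2 := Hder); intros s.
  apply Series_ext; intros j; apply Rmult_comm.
(* The term j = 0 drops out because [tri 0 = 0]. *)
rewrite Series_incr_1_aux by (simpl; ring).
unfold theta2; rewrite <- Series_scal_l; apply Series_ext; intros k.
replace (INR (tri (S k))) with (INR ((k + 1) * (k + 2)) / 2).
  rewrite tri_S; replace (pred (tri k + S k)) with (tri k + k)%nat by lia.
  rewrite Rpow_mult_distr, pow_add; simpl; field.
replace ((k + 1) * (k + 2))%nat with (2 * tri (S k))%nat by (rewrite double_tri; lia).
rewrite mult_INR; simpl (INR 2); field.
Qed.

Theorem proposition11 :
  (forall q x : R, 0 < q < 1 -> - Rpower q (- (3 / 2)) <= x ->
     ex_derive_n (fun t : R => theta q t) 2 x /\
     Derive_n (fun t : R => theta q t) 2 x > 0) /\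
  (forall q x : R, 0 < q < 1 -> - Rpower q (- (1 / 2)) <= x < 0 ->
     ex_derive (fun s : R => theta s x) q /\
     Derive (fun s : R => theta s x) q < 0) /\
  (forall q x : R, 0 < q < 1 -> 0 < x ->
     ex_derive (fun s : R => theta s x) q /\
     Derive (fun s : R => theta s x) q > 0).
Proof.
(* Both thresholds are the condition y >= - sqrt q of [theta2_pos] at y = q^n x: n = 2 for the
   derivative in [x], n = 1 for that in [q]. *)
assert (Hscale : forall q x (n : nat), 0 < q < 1 -> - Rpower q (/ 2 - INR n) <= x ->
    - sqrt q <= q ^ n * x).
  intros q x n Hq Hx.
  rewrite <- Rpower_sqrt by lra.
  replace (/ 2) with (INR n + (/ 2 - INR n)) by ring.
  rewrite Rpower_plus, Rpower_pow, <- Ropp_mult_distr_r_reverse by lra.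
  apply Rmult_le_compat_l; [apply pow_le; lra|exact Hx].
repeat split.
- apply theta_derive_n_2; assumption.
- rewrite (proj2 (theta_derive_n_2 q x H)).
  apply Rmult_lt_0_compat; [apply pow_lt; lra|].
  apply theta2_pos, Hscale; [assumption|assumption|].
  replace (/ 2 - INR 2) with (- (3 / 2)) by (simpl; field); assumption.
- eexists; apply theta_is_derive_q; assumption.
- rewrite (is_derive_unique (fun s : R => theta s x) _ _ (theta_is_derive_q q x H)).
  enough (0 < theta2 q (q * x)) by nra.
  apply theta2_pos; [assumption|].
  rewrite <- (pow_1 q) at 2; apply Hscale; [assumption|].
  replace (/ 2 - INR 1) with (- (1 / 2)) by (simpl; field); lra.
- eexists; apply theta_is_derive_q; assumption.
- rewrite (is_derive_unique (fun s : R => theta s x) _ _ (theta_is_derive_q q x H)).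
  enough (0 < theta2 q (q * x)) by nra.
  apply theta2_pos; [assumption|].
  generalize (sqrt_pos q); nra.
Qed.
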